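(* Consider an execution of PI-ADMM1 with $N$ agents, and an external eavesdropper who overhears all links, i.e. observes all tokens $z^0,z^1,z^2,\dots$. If $z^{k+1}\neq x_{i_k}^{k+1}$ for all $k\geq 0$, then the exact states $x_i^k$ ($i\in\mathcal{V}$, $k=0,1,\dots$) cannot be inferred by the eavesdropper. The multipliers $y_i^k$ and gradients $\nabla f_i(x_i^k)$ ($i\in\mathcal{V}$, $k=0,1,\dots$) cannot be exactly inferred by the eavesdropper either.
   Context: PI-ADMM1: $\mathcal{V}=\{1,\dots,N\}$ is the set of agents, $f_i:\mathbb{R}^p\to\mathbb{R}$ is the private differentiable function of agent $i$ (with Lipschitz gradient), $\rho>0$ is a parameter, and $i_k=(k\bmod N)+1$ is the agent activated at iteration $k$. Initialization: $z^0=\boldsymbol{0}$, and each agent $i$ privately generates a random $x_i^0\in\mathbb{R}^p$ and sets $y_i^0=\rho x_i^0$. At iteration $k=0,1,2,\dots$ agent $i_k$ privately generates a scalar $\gamma_{i_k}^k>0$, sets $\tilde\rho_{i_k}^k=\rho\gamma_{i_k}^k$, and - (primal) $x_{i_k}^{k+1}=\arg\min_{x}\ f_{i_k}(x)+\frac{\tilde\rho_{i_k}^k}{2}\left\|z^k-x+\frac{y_{i_k}^k}{\tilde\rho_{i_k}^k}\right\|^2$, and $x_i^{k+1}=x_i^k$ for $i\neq i_k$; - (dual) $y_{i_k}^{k+1}=y_{i_k}^k+\rho\gamma_{i_k}^k(z^k-x_{i_k}^{k+1})$, and $y_i^{k+1}=y_i^k$ for $i\ne i_k$; - (token) $z^{k+1}=z^k+\frac1N\left[\left(x_{i_k}^{k+1}-\frac{y_{i_k}^{k+1}}{\rho}\right)-\left(x_{i_k}^{k}-\frac{y_{i_k}^{k}}{\rho}\right)\right]$,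 after which $z^{k+1}$ is transmitted to agent $i_{k+1}$. The optimality condition of the primal update together with the dual update gives $\nabla f_{i_k}(x_{i_k}^{k+1})=y_{i_k}^{k+1}$. Privacy notion: a mechanism is privacy preserving if its input cannot be uniquely derived from its output. Eavesdropper model: the eavesdropper knows $N$, $\rho$, the activation order, the form of the algorithm, and all tokens $z^k$, $k\ge 0$. The quantities $x_i^k$, $y_i^k$, the gradients $\nabla f_i(x_i^k)$, and the scalars $\gamma_{i_k}^k>0$ are unknown to it. The relations available to it among these unknowns are: $x_i^0-y_i^0/\rho=\boldsymbol{0}$ for all $i\in\mathcal{V}$; the dual update and the token update for every $k$; the fact that the variables of non-activated agents do not change; and $\nabla f_{i_k}(x_{i_k}^{k+1})=y_{i_k}^{k+1}$ for every $k$ (the gradient values being treated as unknown vectors). A quantity ''can be (exactly) inferred'' if it takes the same value in all solutions of this system of relations having the observed tokens; otherwise it ''cannot be inferred''. *)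

(* Defs.v *)
From HB Require Import structures.
From mathcomp Require Export all_boot all_order all_algebra.
From mathcomp Require Export all_classical all_reals all_analysis.

Set Implicit Arguments.
Unset Strict Implicit.
Unset Printing Implicit Defensive.

Import Order.TTheory GRing.Theory Num.Theory.
Import numFieldNormedType.Exports.

Local Open Scope classical_set_scope.
Local Open Scope ring_scope.

(* The library norm on row vectors is the sup norm, hence a separate definition
   of the Euclidean one. *)
Definition norm2 (R : realType) (p : nat) (v : 'rV[R]_p) : R :=
  Num.sqrt (\sum_(j < p) v 0 j ^+ 2).

Definition gradient (R : realType) (p : nat) (f : 'rV[R]_p -> R)
    (a : 'rV[R]_p) : 'rV[R]_p :=
  \row_(j < p) 'D_(delta_mx 0 j) (f : 'rV[R]_p -> R^o) a.

Definition differentiable_everywhere (R : realType) (p : nat)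
    (f : 'rV[R]_p -> R) : Prop :=
  forall a : 'rV[R]_p, differentiable (f : 'rV[R]_p -> R^o) a.

Definition lipschitz_gradient (R : realType) (p : nat)
    (f : 'rV[R]_p -> R) : Prop :=
  exists L : R, forall a b : 'rV[R]_p,
    norm2 (gradient f a - gradient f b) <= L * norm2 (a - b).

Definition is_argmin (R : realType) (T : Type) (h : T -> R) (a : T) : Prop :=
  forall b : T, h a <= h b.

(* Agents are numbered from 0, so i_k = (k mod N) + 1 becomes k mod N. *)
Definition active (N : nat) (hN : (0 < N)%N) (k : nat) : 'I_N :=
  Ordinal (ltn_pmod k hN).

Definition dual_update (R : realType) (N p : nat) (hN : (0 < N)%N) (rho : R)
    (x y : 'I_N -> nat -> 'rV[R]_p) (gam : nat -> R) (z : nat -> 'rV[R]_p)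
    : Prop :=
  forall k, let i := active hN k in
    y i k.+1 = y i k + (rho * gam k) *: (z k - x i k.+1).

Definition token_update (R : realType) (N p : nat) (hN : (0 < N)%N) (rho : R)
    (x y : 'I_N -> nat -> 'rV[R]_p) (z : nat -> 'rV[R]_p) : Prop :=
  forall k, let i := active hN k in
    z k.+1 = z k + (N%:R)^-1 *: ((x i k.+1 - rho^-1 *: y i k.+1)
                                 - (x i k - rho^-1 *: y i k)).

Definition idle_unchanged (R : realType) (N p : nat) (hN : (0 < N)%N)
    (w : 'I_N -> nat -> 'rV[R]_p) : Prop :=
  forall k i, i != active hN k -> w i k.+1 = w i k.

(* [gam k] is the scalar drawn at iteration k by the active agent; [x _ 0] is
   left free, so that every realization of the random initialization is
   covered. *)
Record PI_ADMM1 (R : realType) (N p : nat) (hN : (0 < N)%N) (rho : R)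
    (f : 'I_N -> 'rV[R]_p -> R)
    (x y : 'I_N -> nat -> 'rV[R]_p) (gam : nat -> R) (z : nat -> 'rV[R]_p)
    : Prop := {
  exec_z0 : z 0%N = 0;
  exec_y0 : forall i, y i 0%N = rho *: x i 0%N;
  exec_gam : forall k, 0 < gam k;
  exec_primal : forall k, let i := active hN k in let rhot := rho * gam k in
    is_argmin
      (fun v => f i v + rhot / 2 * norm2 (z k - v + rhot^-1 *: y i k) ^+ 2)
      (x i k.+1);
  exec_x_idle : idle_unchanged hN x;
  exec_dual : dual_update hN rho x y gam z;
  exec_y_idle : idle_unchanged hN y;
  exec_token : token_update hN rho x y z }.

(* [unk_g i k] stands for the value of the gradient of f_i at x_i^k. *)
Record unknowns (R : realType) (N p : nat) : Type := Unknowns {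
  unk_x : 'I_N -> nat -> 'rV[R]_p;
  unk_y : 'I_N -> nat -> 'rV[R]_p;
  unk_g : 'I_N -> nat -> 'rV[R]_p;
  unk_gam : nat -> R }.

Record eavesdropper_system (R : realType) (N p : nat) (hN : (0 < N)%N)
    (rho : R) (z : nat -> 'rV[R]_p) (u : unknowns R N p) : Prop := {
  eav_init : forall i, unk_x u i 0%N - rho^-1 *: unk_y u i 0%N = 0;
  eav_gam : forall k, 0 < unk_gam u k;
  eav_dual : dual_update hN rho (unk_x u) (unk_y u) (unk_gam u) z;
  eav_token : token_update hN rho (unk_x u) (unk_y u) z;
  eav_x_idle : idle_unchanged hN (unk_x u);
  eav_y_idle : idle_unchanged hN (unk_y u);
  eav_g_idle : idle_unchanged hN (unk_g u);
  eav_opt : forall k, let i := active hN k in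
    unk_g u i k.+1 = unk_y u i k.+1 }.

Definition can_be_inferred (R : realType) (N p : nat) (hN : (0 < N)%N)
    (rho : R) (z : nat -> 'rV[R]_p) (T : Type) (Q : unknowns R N p -> T)
    : Prop :=
  forall u v : unknowns R N p,
    eavesdropper_system hN rho z u -> eavesdropper_system hN rho z v ->
    Q u = Q v.

(* Main.v *)
Require Import Defs.
From mathcomp Require Import ring.
Import Order.TTheory GRing.Theory Num.Theory.
Import numFieldNormedType.Exports.
Local Open Scope ring_scope.

Set Implicit Arguments.
Unset Strict Implicit.
Unset Printing Implicit Defensive.

(** The system is invariant under moving the unknown initial states.  Since
    x_i^k - y_i^k / rho is all that enters the token update, shifting x_i by
    c_i^k d and y_i by rho c_i^k d leaves every token unchanged; the dual update
    then only asks that (1 + gamma^k) c_i^(k+1) = c_i^k when agent i is active.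
    With c_i^0 = 1 this makes c_i^k a product of factors 1 / (1 + gamma), which
    never vanishes, so every x_i^k and y_i^k really moves when d <> 0.  Gradients
    are only tied to the multipliers, so they may be taken equal to them and move
    along. *)

Definition damping (R : realType) (N : nat) (hN : (0 < N)%N) (gam : nat -> R)
    (i : 'I_N) (k : nat) : R :=
  \prod_(j < k | active hN j == i) (1 + gam j)^-1.

Section Damping.
Variables (R : realType) (N : nat) (hN : (0 < N)%N) (gam : nat -> R).
Hypothesis gam_gt0 : forall k, 0 < gam k.

Lemma damping_active k :
  damping hN gam (active hN k) k.+1
  = damping hN gam (active hN k) k / (1 + gam k).
Proof. by rewrite /damping big_mkcond big_ord_recr -big_mkcond /= eqxx. Qed.

Lemma damping_idle k i :
  i != active hN k -> damping hN gam i k.+1 = damping hN gam i k.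
Proof.
rewrite eq_sym => /negPf ik.
by rewrite /damping big_mkcond big_ord_recr -big_mkcond /= ik mulr1.
Qed.

Lemma damping_neq0 i k : damping hN gam i k != 0.
Proof.
apply: lt0r_neq0; apply: prodr_gt0 => j _.
by rewrite invr_gt0 addr_gt0.
Qed.

End Damping.

Definition shifted (R : realType) (N p : nat) (hN : (0 < N)%N) (rho : R)
    (x y : 'I_N -> nat -> 'rV[R]_p) (gam : nat -> R) (d : 'rV[R]_p)
    : unknowns R N p :=
  let y' i k := y i k + (rho * damping hN gam i k) *: d in
  Unknowns (fun i k => x i k + damping hN gam i k *: d) y' y' gam.

Lemma shifted_eavesdropper_system (R : realType) (N p : nat) (hN : (0 < N)%N)
    (rho : R) (f : 'I_N -> 'rV[R]_p -> R) (x y : 'I_N -> nat -> 'rV[R]_p)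
    (gam : nat -> R) (z : nat -> 'rV[R]_p) (d : 'rV[R]_p) :
  rho != 0 -> PI_ADMM1 hN rho f x y gam z ->
  eavesdropper_system hN rho z (shifted hN rho x y gam d).
Proof.
move=> rho0 [_ y0 gam0 _ xidle dual yidle token].
have gap i k : unk_x (shifted hN rho x y gam d) i k
    - rho^-1 *: unk_y (shifted hN rho x y gam d) i k
    = x i k - rho^-1 *: y i k.
  by rewrite /= scalerDr scalerA mulKf // opprD addrACA subrr addr0.
have yidle' : idle_unchanged hN (unk_y (shifted hN rho x y gam d)).
  by move=> k i ik /=; rewrite yidle // damping_idle.
(* Gradients coincide with multipliers, so optimality is trivial and gradient idleness is
   [yidle']. *)
split=> //.
- by move=> i; rewrite gap y0 scalerA mulVf // scale1r subrr.
(* With c' = c / (1 + gamma), the coefficients of [d] balance: rho c' = rho c - rho gamma c'. *)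
- move=> k /=; rewrite dual damping_active.
  have g1 : 1 + gam k != 0 by rewrite lt0r_neq0 // addr_gt0.
  by apply/rowP => j; rewrite !mxE; field.
- by move=> k i; rewrite !gap; exact: token.
- by move=> k i ik /=; rewrite xidle // damping_idle.
Qed.

Theorem theorem2 (R : realType) (N p : nat) (hN : (0 < N)%N)
  (rho : R) (hrho : 0 < rho)
  (f : 'I_N -> 'rV[R]_p -> R)
  (hdiff : forall i, differentiable_everywhere (f i))
  (hlip : forall i, lipschitz_gradient (f i))
  (x y : 'I_N -> nat -> 'rV[R]_p) (gam : nat -> R) (z : nat -> 'rV[R]_p)
  (hexec : PI_ADMM1 hN rho f x y gam z)
  (hz : forall k : nat, z k.+1 <> x (active hN k) k.+1) :
  (forall (i : 'I_N) (k : nat),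
     ~ can_be_inferred hN rho z (fun u : unknowns R N p => unk_x u i k)) /\
  (forall (i : 'I_N) (k : nat),
     ~ can_be_inferred hN rho z (fun u : unknowns R N p => unk_y u i k)) /\
  (forall (i : 'I_N) (k : nat),
     ~ can_be_inferred hN rho z (fun u : unknowns R N p => unk_g u i k)).
Proof.
have rho0 : rho != 0 by rewrite gt_eqF.
(* A nonzero vector exists only if p > 0; [hz] provides one. *)
pose d := z 1%N - x (active hN 0) 1%N.
have d0 : d != 0 by rewrite subr_eq0; apply/eqP/hz.
have sys e := @shifted_eavesdropper_system _ _ _ _ _ _ _ _ _ _ e rho0 hexec.
have c0 i k : damping hN gam i k != 0 := damping_neq0 hN (exec_gam hexec) i k.
have moves (v : 'rV[R]_p) (a : R) : a != 0 -> v + a *: d <> v + a *: 0.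
  move=> a0 /addrI /eqP.
  by rewrite scaler0 scaler_eq0 (negPf a0) (negPf d0).
(* The zero shift keeps the executed [x] and [y], with [y] as gradients; the shift by [d] differs
   from it at every agent and time. *)
by split; [|split] => i k /(_ _ _ (sys d) (sys 0));
  apply: moves; rewrite ?mulf_neq0.
Qed.
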